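(* For each integer $n\geq 3$, the prism graph $\Pi_n=C_n\square K_2$ satisfies $\operatorname{sum}(\Pi_n)=5$.
   Context: For a finite simple graph $G$ and an injective labelling $f:V(G)\to\mathbb{Z}$, define $f_+(uv)=f(u)+f(v)$ for $uv\in E(G)$. The sum index $\operatorname{sum}(G)$ is the minimum, over all injective $f:V(G)\to\mathbb{Z}$, of the number of distinct values taken by $f_+$ on $E(G)$. Here $C_n$ is the cycle on $n$ vertices, $K_2$ is the graph consisting of a single edge, and $\square$ denotes the Cartesian product of graphs. *)

(* Defs.v *)
From mathcomp Require Import all_boot ssralg ssrint.
From mathcomp Require Import boolp.

Set Implicit Arguments.
Unset Strict Implicit.
Unset Printing Implicit Defensive.

Record sgraph := SGraph {
  vertex :> finType;
  adj : rel vertex;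
  adj_sym : symmetric adj;
  adj_irrefl : irreflexive adj
}.

(* An edge uv is represented by both ordered pairs (u, v) and (v, u); they have
   the same sum, so the set of values of f_+ is unaffected. *)
Definition edge_sums (G : sgraph) (f : G -> int) : seq int :=
  undup [seq (f e.1 + f e.2)%R | e : G * G in [pred e | adj e.1 e.2]].

Definition num_edge_sums (G : sgraph) (f : G -> int) : nat :=
  size (edge_sums f).

Definition attains_sums (G : sgraph) (k : nat) : Prop :=
  exists f : G -> int, injective f /\ num_edge_sums f = k.

Lemma attains_sums_exists (G : sgraph) : exists k, `[< attains_sums G k >].
Proof.
pose f (v : G) := Posz (enum_rank v).
exists (num_edge_sums f); apply/asboolP; exists f; split => //.
by move=> u v [/ord_inj /enum_rank_inj].
Qed.

Definition sum_index (G : sgraph) : nat := ex_minn (attains_sums_exists G).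

(* ordS i is i + 1 modulo n. The conjunct i != j only matters for n = 1, where
   it keeps the relation irreflexive. *)
Definition cycle_adj (n : nat) : rel 'I_n :=
  fun i j => (i != j) && ((j == ordS i) || (i == ordS j)).

Lemma cycle_adj_sym n : symmetric (@cycle_adj n).
Proof. by move=> i j; rewrite /cycle_adj eq_sym orbC. Qed.

Lemma cycle_adj_irrefl n : irreflexive (@cycle_adj n).
Proof. by move=> i; rewrite /cycle_adj eqxx. Qed.

Definition cycle_graph (n : nat) : sgraph :=
  SGraph (@cycle_adj_sym n) (@cycle_adj_irrefl n).

Definition complete_adj (n : nat) : rel 'I_n := fun i j => i != j.

Lemma complete_adj_sym n : symmetric (@complete_adj n).
Proof. by move=> i j; rewrite /complete_adj eq_sym. Qed.

Lemma complete_adj_irrefl n : irreflexive (@complete_adj n).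
Proof. by move=> i; rewrite /complete_adj eqxx. Qed.

Definition complete_graph (n : nat) : sgraph :=
  SGraph (@complete_adj_sym n) (@complete_adj_irrefl n).

Definition cartesian_adj (G H : sgraph) : rel (G * H) := fun x y =>
  ((x.1 == y.1) && adj x.2 y.2) || (adj x.1 y.1 && (x.2 == y.2)).

Lemma cartesian_adj_sym (G H : sgraph) : symmetric (@cartesian_adj G H).
Proof.
move=> x y; rewrite /cartesian_adj (eq_sym x.1) (eq_sym x.2).
by rewrite (adj_sym x.1) (adj_sym x.2).
Qed.

Lemma cartesian_adj_irrefl (G H : sgraph) : irreflexive (@cartesian_adj G H).
Proof. by move=> x; rewrite /cartesian_adj !adj_irrefl andbF. Qed.

Definition cartesian_product (G H : sgraph) : sgraph :=
  SGraph (@cartesian_adj_sym G H) (@cartesian_adj_irrefl G H).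

Definition prism (n : nat) : sgraph :=
  cartesian_product (cycle_graph n) (complete_graph 2).

(* Main.v *)
(* Lower bound: let v carry the largest label and let w be its neighbour of
   smallest label. If all degrees are at least d, then the edges at v give d sums
   that are at least f v + f w, and the other edges at w give d - 1 smaller ones,
   hence 2 d - 1 sums in any injective labelling.
   Upper bound: label one cycle by twice the zigzag 0, n-1, 1, n-2, ..., whose
   consecutive sums are 2n-2 and 2n except for the closing edge, and complement
   each label to 2n-1 on the other cycle. The rungs all have sum 2n-1, and
   s |-> 4n-2-s, which carries the sums of the first cycle to those of the
   second, exchanges 2n-2 and 2n, so only the two closing edges add new values. *)
Require Import Defs.
From mathcomp Require Import all_boot.
From mathcomp Require Import all_order ssralg ssrnum ssrint boolp zify.

Set Implicit Arguments.
Unset Strict Implicit.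
Unset Printing Implicit Defensive.

Import Order.TTheory GRing.Theory Num.Theory.

Lemma sum_index_attained (G : sgraph) :
  exists2 f : G -> int, injective f & num_edge_sums f = sum_index G.
Proof.
rewrite /sum_index; case: ex_minnP => m /asboolP[f [injf fm]] _.
by exists f.
Qed.

Lemma sum_index_le (G : sgraph) (f : G -> int) :
  injective f -> sum_index G <= num_edge_sums f.
Proof.
move=> injf; rewrite /sum_index; case: ex_minnP => m _; apply.
by apply/asboolP; exists f.
Qed.

Lemma mem_edge_sums (G : sgraph) (f : G -> int) (u v : G) :
  adj u v -> (f u + f v)%R \in edge_sums f.
Proof.
by move=> uv; rewrite mem_undup; apply/imageP; exists (u, v).
Qed.

Lemma edge_sumsP (G : sgraph) (f : G -> int) (s : int) :
  s \in edge_sums f -> exists u v : G, adj u v /\ s = (f u + f v)%R.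
Proof.
by rewrite mem_undup => /imageP[[u v] /= uv ->]; exists u, v.
Qed.

Lemma num_edge_sums_ge (G : sgraph) (d : nat) (v0 : G) (f : G -> int) :
    (forall v : G, d <= #|adj v|) -> injective f ->
  d.*2.-1 <= num_edge_sums f.
Proof.
case: d => [//|d] degG injf.
case: (@arg_maxP _ _ _ v0 predT f isT) => v _ vmax.
have [w0 vw0] : exists w, w \in adj v.
  by apply/card_gt0P; apply: leq_trans (degG v).
case: (@arg_minP _ _ _ w0 (adj v) f vw0) => w vw wmin.
pose A := [seq (f v + f x)%R | x <- enum (adj v)].
pose B := [seq (f w + f x)%R | x <- enum [predD1 adj w & v]].
have uniqAB : uniq (A ++ B).
  rewrite cat_uniq !map_inj_uniq ?enum_uniq //=; last 2 first.
  - by move=> x y /addrI/injf.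
  - by move=> x y /addrI/injf.
  rewrite andbT; apply/hasPn => _ /mapP[x + ->].
  rewrite mem_enum => /andP[/= xv _]; apply/mapP => -[y].
  rewrite mem_enum => vy.
  (* Maximality and injectivity give [f x < f v], minimality gives [f w <= f y], so
     [f w + f x < f v + f y]. *)
  have /= := wmin y vy; have /= := vmax x isT.
  have : f x != f v by rewrite (inj_eq injf).
  lia.
have subAB : {subset A ++ B <= edge_sums f}.
  move=> s; rewrite mem_cat => /orP[] /mapP[x + ->]; rewrite mem_enum.
  - exact: mem_edge_sums.
  - by case/andP => _; apply: mem_edge_sums.
have := uniq_leq_size uniqAB subAB.
rewrite size_cat !size_map -!cardE /num_edge_sums.
have := degG v; have := degG w; rewrite (cardD1 v (adj w)).
rewrite -[v \in adj w]/(adj w v) adj_sym.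
have -> : adj v w = true by [].
move=> degw degv /(leq_trans _); apply.
by rewrite /= -addnn -addSn leq_add.
Qed.

Lemma ordS_val (n : nat) (i : 'I_n) :
  ordS i = (if i.+1 == n then 0 else i.+1) :> nat.
Proof.
case: eqP => [/= -> | ni] /=; first exact: modnn.
by rewrite modn_small //; have := ltn_ord i; lia.
Qed.

Lemma prism_degree (n : nat) (v : prism n) : 2 < n -> 2 < #|adj v|.
Proof.
move=> n_gt2; case: v => i e.
have S1 (j : 'I_n) : ordS j != j.
  by apply/eqP => /(congr1 (@nat_of_ord n)); rewrite ordS_val; case: eqP; lia.
(* Here [n > 2] is essential: for [n = 2] the two cycle neighbours coincide. *)
have S2 (j : 'I_n) : ordS (ordS j) != j.
  apply/eqP => /(congr1 (@nat_of_ord n)); rewrite !ordS_val.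
  by case: (j.+1 =P n) => ?; case: eqP; lia.
have e'e : rev_ord e != e by case: e => [[|[|]]].
have Pi : ord_pred i != i by have := S1 (ord_pred i); rewrite ord_predK eq_sym.
have SP : ordS i != ord_pred i by have := S2 (ord_pred i); rewrite ord_predK.
pose s := [:: (i, rev_ord e); (ordS i, e); (ord_pred i, e)] : seq (prism n).
have uniq_s : uniq s.
  by rewrite /= !inE !xpair_eqE (negPf e'e) (negPf SP) !andbF.
rewrite cardE; apply: (uniq_leq_size uniq_s) => x.
rewrite mem_enum !inE => /or3P[] /eqP ->;
  rewrite unfold_in /= /cartesian_adj /= /complete_adj /cycle_adj.
- by rewrite eqxx eq_sym e'e.
- by rewrite eqxx eqxx eq_sym S1 orbT.
- by rewrite ord_predK !eqxx eq_sym Pi !orbT.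
Qed.

Definition zigzag (n i : nat) : nat := if odd i then n.-1 - i./2 else i./2.

(** With [k = i./2], the sum is [k + (n-1-k)] for even [i] and [(n-1-k) + (k+1)] for odd [i]. *)
Lemma zigzagS (n i : nat) : i.+1 < n ->
  zigzag n i + zigzag n i.+1 = if odd i then n else n.-1.
Proof.
rewrite /zigzag /= uphalf_half; have := odd_double_half i.
by case: odd => /=; lia.
Qed.

Lemma zigzag_lt (n i : nat) : i < n -> zigzag n i < n.
Proof. rewrite /zigzag; case: ifP => /=; lia. Qed.

(** A collision between positions [2a] and [2b+1] would force [a + b = n-1], so the positions would
    add up to [2n-1], more than [2(n-1)]. *)
Lemma zigzag_inj (n i j : nat) :
  i < n -> j < n -> zigzag n i = zigzag n j -> i = j.
Proof. rewrite /zigzag; case: ifP => oi; case: ifP => oj; lia. Qed.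

(** The subtraction in [nat] never truncates, since [a <= 2n-2] by [zigzag_lt]. *)
Definition prism_label (n : nat) (v : prism n) : int :=
  let a := (zigzag n v.1).*2 in
  if v.2 == ord0 then Posz a else Posz (n.*2.-1 - a).

(** The parity of a label reveals the copy: even on [ord0], odd on the other. Then [zigzag_inj]
    recovers the position. *)
Lemma prism_label_inj (n : nat) : injective (@prism_label n).
Proof.
move=> [i e] [j e']; rewrite /prism_label /=.
have := zigzag_lt (ltn_ord i); have := zigzag_lt (ltn_ord j).
have ij : zigzag n i = zigzag n j -> i = j.
  by move/(zigzag_inj (ltn_ord i) (ltn_ord j))/val_inj.
have ee : (e == ord0) = (e' == ord0) -> e = e'.
  case: e e' => [[|[|e]] //= ?] [[|[|e']] //= ?] // _; exact: val_inj.
case: (e == ord0) (e' == ord0) ee => [] [] ee lti ltj eqf; last first.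
- by rewrite ij ?ee //; lia.
- lia.
- lia.
- by rewrite ij ?ee //; lia.
Qed.

Lemma zigzag_cycle (n : nat) (i : 'I_n) :
  zigzag n i + zigzag n (ordS i) \in [:: n.-1; n; zigzag n n.-1].
Proof.
have [lt|ge] := ltnP i.+1 n.
  by rewrite /= modn_small // zigzagS //; case: odd; rewrite !inE eqxx ?orbT.
(* On the closing edge [ordS i] is 0, where the zigzag vanishes. *)
have ni : i.+1 = n by have := ltn_ord i; lia.
have -> : n.-1 = i by lia.
by rewrite /= ni modnn addn0 !inE eqxx !orbT.
Qed.

Lemma prism_label_sums (n : nat) : num_edge_sums (@prism_label n) <= 5.
Proof.
pose r := zigzag n n.-1.
(* In order: the two values shared by the non-closing edges of both copies, the closing edge of copy
   [ord0], the rungs, the other closing edge. *)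
apply: (@uniq_leq_size _ _
  [:: Posz n.-1.*2; Posz n.*2; Posz r.*2; Posz n.*2.-1;
      (Posz (n.*2.-1).*2 - Posz r.*2)%R]); first exact: undup_uniq.
have cyc (i j : 'I_n) : cycle_adj i j ->
    zigzag n i + zigzag n j \in [:: n.-1; n; r].
  by case/andP => _ /orP[] /eqP ->; last rewrite addnC; apply: zigzag_cycle.
move=> s /edge_sumsP[[i e] [[j e'] [+ ->]]].
have := zigzag_lt (ltn_ord i); have := zigzag_lt (ltn_ord j).
rewrite /= /cartesian_adj /prism_label /= => ltj lti /orP[] /andP[].
- move/eqP=> ij; rewrite -{j}ij /complete_adj in ltj *.
  by case: e e' => [[|[|e]] //= ?] [[|[|e']] //= ?] // _; rewrite !inE; lia.
- move/cyc; rewrite !inE => abr /eqP ->.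
  by case: ifP => _; lia.
Qed.

Theorem corollary3p3 (n : nat) (hn : 3 <= n) : sum_index (prism n) = 5.
Proof.
apply/eqP; rewrite eqn_leq; apply/andP; split.
  exact: leq_trans (sum_index_le (@prism_label_inj n)) (prism_label_sums n).
have [f injf <-] := sum_index_attained (prism n).
have n_gt0 : 0 < n by apply: leq_trans hn.
pose v0 : prism n := (Ordinal n_gt0, ord0).
by apply: (@num_edge_sums_ge _ 3 v0) => // v; apply: prism_degree.
Qed.
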